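(* Let $k$ be a field of characteristic $\neq 2$, let $l\ge 1$, let $n=2l$ or $n=2l+1$, and let $g\in \mathrm{O}(n,k)$ be an element of the split orthogonal group. Then $g$ can be written as a product in which one factor is a diagonal matrix in $\mathrm{O}(n,k)$ of the form $\mathrm{diag}(1,\ldots,1,\lambda,1,\ldots,1,\lambda^{-1})$ if $n=2l$, respectively $\mathrm{diag}(\alpha,1,\ldots,1,\lambda,1,\ldots,1,\lambda^{-1})$ if $n=2l+1$ (with $\lambda,\alpha\in k^\times$; $\lambda$ in position $l$ and $\lambda^{-1}$ in position $-l$), and all other factors are elementary matrices; and for such an expression of $g$ the image of $\lambda$ in $k^\times/k^{\times 2}$ is the spinor norm $\Theta(g)$.
   Context: ${}^{T}X$ denotes the transpose of $X$; $e_{a,b}$ denotes the matrix unit with $1$ in position $(a,b)$. The split orthogonal group is $\mathrm{O}(n,k)=\{g\in\mathrm{GL}(n,k): {}^{T}g\beta g=\beta\}$ with $\beta=\begin{pmatrix}0 & I_l \\ I_l & 0\end{pmatrix}$ for $n=2l$ and $\beta=\begin{pmatrix}2 & 0 & 0 \\ 0 & 0 & I_l \\ 0 & I_l & 0\end{pmatrix}$ for $n=2l+1$; write also $\beta(x,y)={}^{T}x\beta y$ for column vectors. Rows and columns are indexed in order by $1,\ldots,l,-1,\ldots,-l$ if $n=2l$ and by $0,1,\ldots,l,-1,\ldots,-l$ if $n=2l+1$. Elementary matrices ($t\in k$, $1\le i,j\le l$): $x_{i,j}(t)=I+t(e_{i,j}-e_{-j,-i})$ for $i\neq j$; $x_{i,-j}(t)=I+t(e_{i,-j}-e_{j,-i})$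 for $i<j$; $x_{-i,j}(t)=I+t(e_{-i,j}-e_{-j,i})$ for $i<j$; $w_l=I-e_{l,l}-e_{-l,-l}-e_{l,-l}-e_{-l,l}$; and, only for $n=2l+1$, also $x_{i,0}(t)=I+t(2e_{i,0}-e_{0,-i})-t^2e_{i,-i}$ and $x_{0,i}(t)=I+t(-2e_{-i,0}+e_{0,i})-t^2e_{-i,i}$. Spinor norm: for $u$ with $\beta(u,u)\ne0$ let $\rho_u(v)=v-2\frac{\beta(u,v)}{\beta(u,u)}u$. The spinor norm is the (well-defined) group homomorphism $\Theta:\mathrm{O}(n,k)\to k^\times/k^{\times2}$ given by $\Theta(g)=\prod_{i=1}^m\tfrac12\beta(u_i,u_i)\cdot k^{\times 2}$ whenever $g=\rho_{u_1}\cdots\rho_{u_m}$. *)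

(* Defs.v *)
From mathcomp Require Import all_boot all_order all_algebra.
From mathcomp Require Import classical_sets.

Set Implicit Arguments.
Unset Strict Implicit.
Unset Printing Implicit Defensive.

Import GRing.Theory.
Local Open Scope classical_set_scope.
Local Open Scope ring_scope.

(* The elements of k^* / k^*2 are represented as cosets, i.e. subsets of k:
   [sqclass x] is the coset x k^*2 (for x != 0). *)
Definition sqclass (k : fieldType) (x : k) : set k :=
  [set c | exists2 s : k, s != 0 & c = x * s ^+ 2].

(* n = 2l for b = false and n = 2l + 1 for b = true. *)
Definition dimO (b : bool) (l : nat) : nat := b + (l + l).

Section SplitOrthogonal.
Variables (k : fieldType) (b : bool) (l : nat).

Local Notation n := (dimO b l).

(* The rows and columns 1, ..., l are numbered from 0 here: for
   i : 'I_l, [pos i] is the index i + 1 and [neg i] is the index -(i + 1).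
   ['I_b] is empty for b = false and has one element for b = true, so that
   [zer z] is the index 0, which exists only if n is odd. *)
Definition zer (z : 'I_b) : 'I_n := lshift (l + l) z.
Definition pos (i : 'I_l) : 'I_n := rshift b (lshift l i).
Definition neg (i : 'I_l) : 'I_n := rshift b (rshift l i).

Definition beta : 'M[k]_n :=
  block_mx (2%:R)%:M 0 0 (block_mx 0 1%:M 1%:M 0).

Definition bform (x y : 'cV[k]_n) : k := (x^T *m beta *m y) 0 0.

Definition split_orthogonal (g : 'M[k]_n) : bool :=
  (g \in unitmx) && (g^T *m beta *m g == beta).

Local Notation e i j := (delta_mx i j : 'M[k]_n).

Inductive elementary : 'M[k]_n -> Prop :=
| elem_pos_pos (i j : 'I_l) (t : k) of i != j :
    elementary (1%:M + t *: (e (pos i) (pos j) - e (neg j) (neg i)))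
| elem_pos_neg (i j : 'I_l) (t : k) of (i < j)%N :
    elementary (1%:M + t *: (e (pos i) (neg j) - e (pos j) (neg i)))
| elem_neg_pos (i j : 'I_l) (t : k) of (i < j)%N :
    elementary (1%:M + t *: (e (neg i) (pos j) - e (neg j) (pos i)))
| elem_w (i : 'I_l) of i.+1 = l :
    elementary (1%:M - e (pos i) (pos i) - e (neg i) (neg i)
                     - e (pos i) (neg i) - e (neg i) (pos i))
| elem_pos_zer (z : 'I_b) (i : 'I_l) (t : k) :
    elementary (1%:M + t *: (2%:R *: e (pos i) (zer z) - e (zer z) (neg i))
                     - t ^+ 2 *: e (pos i) (neg i))
| elem_zer_pos (z : 'I_b) (i : 'I_l) (t : k) :
    elementary (1%:M + t *: (- (2%:R *: e (neg i) (zer z)) + e (zer z) (pos i))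
                     - t ^+ 2 *: e (neg i) (pos i)).

(* diag(alpha, 1, ..., 1, lam, 1, ..., 1, lam^-1); for b = false the block of
   alpha is empty and alpha is a dummy argument. *)
Definition diag_factor (alpha lam : k) : 'M[k]_n :=
  diag_mx (row_mx (const_mx alpha : 'rV_b)
    (row_mx (\row_(i < l) (if i.+1 == l then lam else 1))
            (\row_(i < l) (if i.+1 == l then lam^-1 else 1)))).

Definition mxprod (s : seq 'M[k]_n) : 'M[k]_n := \prod_(x <- s) x.

Definition expression (g : 'M[k]_n) (alpha lam : k) (xs ys : seq 'M[k]_n) :
    Prop :=
  [/\ [/\ alpha != 0, lam != 0 & split_orthogonal (diag_factor alpha lam)],
      forall x, x \in xs -> elementary x,
      forall y, y \in ys -> elementary y
    & g = mxprod (xs ++ diag_factor alpha lam :: ys)].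

Definition reflection (u v : 'cV[k]_n) : 'cV[k]_n :=
  v - (2%:R * (bform u v / bform u u)) *: u.

(* The union of the cosets attached to all the decompositions of g into
   reflections (the empty one included). That the spinor norm is well defined
   at g means that this set is a single coset; it is not built into the
   definition, so that [spinor_norm g = sqclass x] also asserts it. *)
Definition spinor_norm (g : 'M[k]_n) : set k :=
  [set c | exists us : seq 'cV[k]_n,
    [/\ forall u, u \in us -> bform u u != 0,
        forall v, g *m v = foldr reflection v us
      & sqclass (\prod_(u <- us) (2%:R^-1 * bform u u)) c]].

End SplitOrthogonal.

(* Main.v *)
(** The spinor norm is well defined because a product of reflections in
    u_1, ..., u_m is 1 - U T^-1 U^T beta, where U has the columns u_i and T is
    upper triangular with diagonal entries q(u_i) = beta(u_i, u_i) / 2 and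
    T + T^T = U^T beta U (the Wall form). If the product is 1, then
    N = T^-1 U^T (beta / 4) U satisfies N^2 = 0 and T (1 - N)^2 = (T - T^T) / 2
    is skew-symmetric, so that det T = q(u_1) ... q(u_m) is a square.

    Every elementary matrix other than w_l is a Siegel transformation
    v + beta(e, v) w - beta(w, v) e - q(w) beta(e, v) e with e isotropic and w
    orthogonal to e. It is the product of the reflections in w and w + q(w) e
    if w is anisotropic, hence has trivial spinor norm.

    Siegel transformations along a basis vector e map an isotropic vector v to
    any isotropic v' with beta(e, v) = beta(e, v') <> 0. Using them, g is
    multiplied on the left until it fixes all hyperbolic pairs but the last one;
    what remains is a diagonal factor, up to w_l. *)

Require Import Defs.
From mathcomp Require Import all_boot all_order all_algebra.
From mathcomp Require Import classical_sets.
From mathcomp Require Import perm ring.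

Set Implicit Arguments.
Unset Strict Implicit.
Unset Printing Implicit Defensive.

Import GRing.Theory.
Local Open Scope ring_scope.

Lemma natr2_neq0 (k : fieldType) : 2%N \notin [pchar k] -> 2%:R != 0 :> k.
Proof. by apply: contra => k2; rewrite inE k2. Qed.

(** * Determinants of skew-symmetric matrices *)

Section SkewDeterminant.
Variables (k : fieldType) (k2 : 2%:R != 0 :> k).

Lemma skew_diag m (A : 'M[k]_m) i : A^T = - A -> A i i = 0.
Proof.
move=> /matrixP/(_ i i)/eqP; rewrite !mxE.
by rewrite -addr_eq0 -mulr2n -mulr_natl mulf_eq0 (negPf k2) => /eqP.
Qed.

Lemma skew_congr m p (A : 'M[k]_m) (P : 'M[k]_(p, m)) :
  A^T = - A -> (P *m A *m P^T)^T = - (P *m A *m P^T).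
Proof. by move=> skA; rewrite !trmx_mul trmxK skA mulNmx mulmxN mulmxA. Qed.

Lemma skew2 (J : 'M[k]_2) :
  J^T = - J -> J 0 1 != 0 -> J \in unitmx /\ \det J = J 0 1 ^+ 2.
Proof.
move=> skJ J01; suff dJ : \det J = J 0 1 ^+ 2.
  by split; rewrite // unitmxE dJ unitfE expf_neq0.
have J10 : J 1 0 = - J 0 1 by have /matrixP/(_ 0 1) := skJ; rewrite !mxE.
rewrite (expand_det_row _ 0) !big_ord_recl big_ord0 /cofactor !det_mx11 !mxE /=.
have E1 : lift 0 0 = 1 :> 'I_2 by apply/val_inj.
have E0 : lift 1 0 = 0 :> 'I_2 by apply/val_inj.
by rewrite E1 E0 skew_diag // J10 /bump /=; ring.
Qed.

(** Induction on the size by splitting off a regular skew 2 x 2 block: its Schur complement is again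
    skew, and its determinant is the square of its off-diagonal entry. In odd size the process ends
    in determinant 0. *)
Lemma skew_det_square m (A : 'M[k]_m) :
  A^T = - A -> exists s, \det A = s ^+ 2.
Proof.
have [p le_mp] := ubnP m; elim: p => // p IHp in m le_mp A *.
case: m le_mp A => [_ A _|[_ A skA|m le_mp A skA]].
- by exists 1; rewrite det_mx00 expr1n.
- by exists 0; rewrite [A]mx11_scalar det_scalar1 skew_diag // expr0n.
case: (pickP (fun i => A 0 i != 0)) => [i A0i|A0]; last first.
  exists 0; rewrite expr0n (expand_det_row _ 0) big1 // => i _.
  by have /negbFE/eqP-> := A0 i; rewrite mul0r.
have i0 : i != 0 by apply: contraNneq A0i => ->; rewrite skew_diag.
(* Conjugation by this transposition moves the nonzero entry to position (0, 1), index 0 being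
   fixed; the sign enters the determinant twice. *)
pose P : 'M[k]_(2 + m) := tperm_mx 1 i.
have Pt : P^T = P by rewrite tr_perm_mx tpermV.
have P2 : (\det P) ^+ 2 = 1 by rewrite det_perm sqrr_sign.
pose B : 'M_(2 + m) := P *m A *m P^T.
have skB : B^T = - B by exact: skew_congr.
have dB : \det B = \det A.
  by rewrite !det_mulmx det_tr mulrAC -expr2 P2 mul1r.
have BE x y : B x y = A (tperm 1 i x) (tperm 1 i y).
  by rewrite /B Pt -xcolE -xrowE !mxE.
have B01 : ulsubmx B 0 1 != 0.
  have E0 : lshift m (0 : 'I_2) = 0 :> 'I_(2 + m) by apply/val_inj.
  have E1 : lshift m (1 : 'I_2) = 1 :> 'I_(2 + m) by apply/val_inj.
  by rewrite mxE mxE E0 E1 BE tpermL tpermD // eq_sym.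
have [skJ] : (ulsubmx B)^T = - ulsubmx B /\ (drsubmx B)^T = - drsubmx B.
  rewrite trmx_ulsub trmx_drsub skB.
  by split; apply/matrixP=> x y; rewrite !mxE.
have skC : (ursubmx B)^T = - dlsubmx B.
  by rewrite trmx_ursub skB; apply/matrixP=> x y; rewrite !mxE.
have [Ju dJ] := skew2 skJ B01.
set J := ulsubmx B in B01 skJ skC Ju dJ *; set D := drsubmx B.
set C := ursubmx B in skC *; have dlB : dlsubmx B = - C^T by rewrite skC opprK.
(* This is the Schur complement of [J] in [B]; the plus sign comes from the lower left block
   [- C^T]. *)
move=> skD; have [||s ds] := IHp m _ (D + C^T *m invmx J *m C).
- exact: ltnW.
- have skV : (invmx J)^T = - invmx J.
    rewrite trmx_inv skJ; have := @invmxZ _ _ (-1) J.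
    by rewrite invrN1 !scaleN1r => -> //; rewrite -skJ unitmx_tr.
  have := skew_congr C^T skV; rewrite trmxK => skS.
  by rewrite raddfD /= skD skS opprD.
exists (J 0 1 * s); rewrite exprMn -ds -dJ -dB.
pose L := block_mx 1%:M 0 (C^T *m invmx J) 1%:M.
have dL : \det L = 1 by rewrite det_lblock !det1 mulr1.
rewrite -[LHS]mul1r -dL -det_mulmx -{1}[B]submxK -/J -/C -/D dlB mulmx_block.
rewrite !mul1mx !mul0mx !addr0 mulmxKV // subrr det_ublock.
by rewrite addrC.
Qed.

End SkewDeterminant.

(** * The bilinear form and its isometries *)

Section BilinearForm.
Variables (k : fieldType) (b : bool) (l : nat).
Local Notation n := (dimO b l).
Local Notation beta := (beta k b l).
Implicit Types (u v w e : 'cV[k]_n) (g : 'M[k]_n) (a : k).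

Lemma beta_sym : beta^T = beta.
Proof.
by rewrite /Defs.beta !tr_block_mx !trmx0 !trmx1 tr_scalar_mx.
Qed.

Lemma bformC u v : bform u v = bform v u.
Proof.
rewrite /bform -[in LHS](mxE trmx_key (fun i j => (u^T *m beta *m v) j i)).
by rewrite -/(trmx _) !trmx_mul trmxK beta_sym mulmxA.
Qed.

Lemma bformDr u v w : bform u (v + w) = bform u v + bform u w.
Proof. by rewrite /bform mulmxDr mxE. Qed.

Lemma bformZr u a v : bform u (a *: v) = a * bform u v.
Proof. by rewrite /bform -scalemxAr mxE. Qed.

Lemma bformNr u v : bform u (- v) = - bform u v.
Proof. by rewrite /bform mulmxN mxE. Qed.

Lemma bformDl u v w : bform (u + v) w = bform u w + bform v w.
Proof. by rewrite bformC bformDr !(bformC w). Qed.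

Lemma bformZl a u v : bform (a *: u) v = a * bform u v.
Proof. by rewrite bformC bformZr bformC. Qed.

Lemma bformNl u v : bform (- u) v = - bform u v.
Proof. by rewrite bformC bformNr bformC. Qed.

Lemma bform0r u : bform u 0 = 0.
Proof. by rewrite /bform mulmx0 mxE. Qed.

Lemma bform0l u : bform 0 u = 0.
Proof. by rewrite bformC bform0r. Qed.

Definition bformE :=
  (bformDl, bformDr, bformNl, bformNr, bformZl, bformZr, bform0l, bform0r).

Lemma mul_bform u v w : u *m (v^T *m beta *m w) = bform v w *: u.
Proof. by rewrite [_ *m w]mx11_scalar -/(bform v w) mul_mx_scalar. Qed.

Lemma mx_ext (A B : 'M[k]_n) : (forall v : 'cV_n, A *m v = B *m v) -> A = B.
Proof.
move=> AB; apply/matrixP=> i j.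
by have /colP/(_ i) := AB (delta_mx j 0); rewrite -!colE !mxE.
Qed.

Definition preserves_bform g := forall u v, bform (g *m u) (g *m v) = bform u v.

Lemma split_orthogonal_preserves_bform g :
  split_orthogonal g -> preserves_bform g.
Proof.
case/andP=> _ /eqP gbg u v.
by rewrite /bform -[in RHS]gbg trmx_mul !mulmxA.
Qed.

Lemma preserves_bform_mul g h :
  preserves_bform g -> preserves_bform h -> preserves_bform (g *m h).
Proof. by move=> ig ih u v; rewrite -!mulmxA ig ih. Qed.

Variable k2 : 2%:R != 0 :> k.

Definition qform v : k := 2%:R^-1 * bform v v.

Lemma bform_qform v : bform v v = 2%:R * qform v.
Proof. by rewrite mulVKf. Qed.

Lemma qform_eq0 v : (qform v == 0) = (bform v v == 0).
Proof. by rewrite mulf_eq0 invr_eq0 (negPf k2). Qed.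

Lemma reflectionE u v : reflection u v = v - (bform u v / qform u) *: u.
Proof.
rewrite /reflection; congr (v - _ *: _).
by rewrite [in LHS]bform_qform invfM mulrCA mulVKf.
Qed.

(** * Reflections and the Wall form of their products *)

Lemma reflectionK u : bform u u != 0 -> involutive (reflection u).
Proof.
move=> u0 v; rewrite /reflection !bformE; apply/colP=> i; rewrite !mxE.
by field.
Qed.

Lemma reflection_bform u v w : bform u u != 0 ->
  bform (reflection u v) (reflection u w) = bform v w.
Proof. by move=> u0; rewrite /reflection !bformE (bformC v u); field. Qed.

Lemma foldr_reflectionK us v : (forall u, u \in us -> bform u u != 0) ->
  foldr (@reflection k b l) (foldr (@reflection k b l) v (rev us)) us = v.
Proof.
elim: us v => //= u us IHus v us0.
rewrite rev_cons foldr_rcons IHus ?reflectionK ?us0 ?mem_head // => w wus.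
by rewrite us0 // inE wus orbT.
Qed.

(* In the witness, U has the columns u_i, and T is upper triangular with
   [qform u_i] on the diagonal and [bform u_i u_j] above it. *)
Lemma foldr_reflection_wall us : (forall u, u \in us -> bform u u != 0) ->
  exists m (U : 'M[k]_(n, m)) (T S : 'M[k]_m),
  [/\ T *m S = 1%:M, \det T = \prod_(u <- us) qform u,
      T + T^T = U^T *m beta *m U
    & forall v, foldr (@reflection k b l) v us
                = (1%:M - U *m S *m U^T *m beta) *m v].
Proof.
elim: us => [|u us IHus] us0.
  exists 0, 0, 1%:M, 1%:M; split; first exact: mulmx1.
  - by rewrite det1 big_nil.
  - by apply/matrixP=> -[].
  - by move=> v; rewrite !mul0mx subr0 mul1mx.
have [|m [U [T [S [TS dT TU rU]]]]] := IHus.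
  by move=> w wus; rewrite us0 // inE wus orbT.
have q0 : qform u != 0 by rewrite qform_eq0 us0 ?mem_head.
pose c := u^T *m beta *m U; pose q := qform u.
exists (1 + m)%N, (row_mx u U), (block_mx q%:M c 0 T).
(* The inverse of a block upper triangular matrix. *)
exists (block_mx q^-1%:M (- q^-1 *: (c *m S)) 0 S); split.
- rewrite mulmx_block !(mul0mx, mulmx0, addr0, add0r) TS -scalar_mxM divff //.
  rewrite mul_scalar_mx scalerA mulrN divff // scaleN1r addNr.
  by rewrite -scalar_mx_block.
- by rewrite det_ublock det_scalar1 dT big_cons.
- rewrite tr_block_mx tr_scalar_mx trmx0 tr_row_mx mul_col_mx mul_col_row.
  rewrite add_block_mx addr0 add0r TU -/c; congr block_mx.
    rewrite [RHS]mx11_scalar -/(bform u u) bform_qform.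
    by rewrite -raddfD /= mulr_natl mulr2n.
  by rewrite !trmx_mul beta_sym trmxK mulmxA.
- move=> v /=; rewrite reflectionE rU.
  have -> : row_mx u U *m block_mx q^-1%:M (- q^-1 *: (c *m S)) 0 S
             *m (row_mx u U)^T
    = q^-1 *: (u *m u^T) - q^-1 *: (u *m (c *m S *m U^T)) + U *m S *m U^T.
    rewrite tr_row_mx mul_row_block mulmx0 addr0 mul_row_col mulmxDl addrA.
    by rewrite mul_mx_scalar -!scalemxAl -scalemxAr -scalemxAl scaleNr mulmxA.
  have -> : c *m S *m U^T = u^T *m beta *m (U *m S *m U^T) by rewrite !mulmxA.
  set P := U *m S *m U^T; rewrite -/q mulrC -scalerA -mul_bform !mulmxA.
  rewrite !(mulNmx, mulmxBl, mulmxBr, mulmxDl) -!scalemxAl !mul1mx !mulmxA.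
  by rewrite mulmx1 scalerBr [in RHS]opprD [RHS]addrA addrAC.
Qed.

(** This yields well-definedness: it will be applied to one decomposition of an element followed by
    the reverse of another. *)
Lemma reflections_id_square us : (forall u, u \in us -> bform u u != 0) ->
  (forall v, foldr (@reflection k b l) v us = v) ->
  exists2 s, s != 0 & \prod_(u <- us) qform u = s ^+ 2.
Proof.
move=> us0 us1; have [m [U [T [S [TS dT TU rU]]]]] := foldr_reflection_wall us0.
have USU0 : U *m S *m U^T *m beta = 0.
  apply: mx_ext => v; have := rU v; rewrite us1 mulmxBl mul1mx mul0mx.
  by move/eqP; rewrite eq_sym subr_eq addrC -subr_eq subrr eq_sym => /eqP.
have d0 : \prod_(u <- us) qform u != 0.
  rewrite prodf_seq_neq0; apply/allP=> u uus; rewrite implyTb.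
  by rewrite qform_eq0 us0.
(* The constant 1/4 makes [2 T N] equal to half of [T + T^T]. As [N] squares to 0, [1 - N] is a
   square root of [1 - 2 N], so [T (1 - N)^2] is the skew part of [T]. *)
pose N := (2%:R * 2%:R)^-1 *: (S *m U^T *m beta *m U).
have N2 : N *m N = 0.
  rewrite /N -scalemxAl -scalemxAr !mulmxA -(mulmxA _ U S) -(mulmxA _ (U *m S)).
  rewrite -(mulmxA _ (U *m S *m U^T)) USU0.
  by rewrite !(mul0mx, mulmx0, scaler0).
have N1u : (1%:M - N) *m (1%:M + N) = 1%:M.
  by rewrite mulmxDr mulmx1 mulmxBl mul1mx N2 subr0 subrK.
have dN0 : \det (1%:M - N) != 0.
  have := congr1 determinant N1u; rewrite det_mulmx det1 => dN.
  by apply: contraTneq (oner_neq0 k) => d0'; rewrite -dN d0' mul0r eqxx.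
pose K := T *m (1%:M - N) *m (1%:M - N).
have KE : K = 2%:R^-1 *: (T - T^T).
  rewrite /K -mulmxA mulmxBr mulmx1 mulmxBl mul1mx N2 subr0.
  rewrite !mulmxBr mulmx1 /N -scalemxAr !mulmxA TS mul1mx -TU.
  apply/matrixP=> i j; rewrite !mxE; field.
  by rewrite -[4%N]/(2 * 2)%N natrM mulf_neq0 k2.
have [|s ds] := skew_det_square k2 (A := K).
  by rewrite KE; apply/matrixP=> i j; rewrite !mxE; ring.
have dK : \det K = \prod_(u <- us) qform u * \det (1%:M - N) ^+ 2.
  by rewrite /K !det_mulmx dT -mulrA.
exists (s / \det (1%:M - N)); last first.
  by rewrite expr_div_n -ds dK mulfK // expf_neq0.
apply: contra_neq d0 => s0; have /eqP := dK.
rewrite ds eq_sym -(divfK dN0 s) s0 mul0r expr0n mulf_eq0 expf_eq0 (negPf dN0).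
by rewrite orbF => /eqP.
Qed.

End BilinearForm.

(** * Siegel transformations and their spinor norms *)

Section Siegel.
Variables (k : fieldType) (b : bool) (l : nat).
Local Notation n := (dimO b l).
Local Notation beta := (beta k b l).
Implicit Types (u v w e : 'cV[k]_n) (g : 'M[k]_n) (a t : k).
Implicit Types (s r : bool) (i j : 'I_l) (z : 'I_b).

(** A boolean sign, [true] for positive indices, treats both halves of the basis at once; [~~ s]
    leads to the dual basis vector. *)
Definition idx s i : 'I_n := if s then pos b i else neg b i.
Definition ep s i : 'cV[k]_n := delta_mx (idx s i) 0.
Definition e0 z : 'cV[k]_n := delta_mx (zer l z) 0.

Variant index_spec : 'I_n -> Type :=
  | IndexZer z : index_spec (zer l z)
  | IndexHyp s i : index_spec (idx s i).

Lemma indexP x : index_spec x.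
Proof.
case: (split_ordP x) => [z ->|y ->]; first exact: IndexZer.
case: (split_ordP y) => i ->; [exact: (IndexHyp true)|exact: (IndexHyp false)].
Qed.

Lemma eq_idx s i r j : (idx s i == idx r j) = (s == r) && (i == j).
Proof.
by case: s r => [] []; rewrite /= eq_shift ?eq_lshift ?eq_rshift ?eq_shift.
Qed.

Lemma eq_idx_zer s i z : (idx s i == zer l z) = false.
Proof. by case: s; rewrite eq_shift. Qed.

Lemma eq_zer_idx s i z : (zer l z == idx s i) = false.
Proof. by case: s; rewrite eq_shift. Qed.

Lemma zer_unique z z' : z = z'.
Proof.
by case: b z z' => [z z'|[] //]; rewrite [z]ord1 [z']ord1.
Qed.

Lemma ep_idx s i r j : ep s i (idx r j) 0 = ((s == r) && (i == j))%:R.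
Proof. by rewrite mxE eqxx andbT eq_idx eq_sym [j == i]eq_sym. Qed.

Lemma ep_zer s i z : ep s i (zer l z) 0 = 0.
Proof. by rewrite mxE eq_zer_idx. Qed.

Lemma e0_idx z s i : e0 z (idx s i) 0 = 0.
Proof. by rewrite mxE eq_idx_zer. Qed.

Lemma e0_zer z z' : e0 z (zer l z') 0 = 1.
Proof. by rewrite (zer_unique z' z) mxE !eqxx. Qed.

Lemma ep_beta s i : (ep s i)^T *m beta = delta_mx 0 (idx (~~ s) i).
Proof.
rewrite trmx_delta -rowE; apply/rowP => x; rewrite mxE.
case: (indexP x) => [z|r j]; rewrite [RHS]mxE ?eq_zer_idx ?eq_idx /=.
  by case: s => /=; rewrite block_mxEdl mxE.
by case: s r => [] [] /=; rewrite block_mxEdr ?block_mxEul ?block_mxEur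
  ?block_mxEdl ?block_mxEdr !mxE // eq_sym.
Qed.

Lemma e0_beta z : (e0 z)^T *m beta = 2%:R *: delta_mx 0 (zer l z).
Proof.
rewrite trmx_delta -rowE; apply/rowP => x; rewrite mxE.
case: (indexP x) => [z'|r j].
  by rewrite block_mxEul !mxE (zer_unique z' z) !eqxx mulr1.
rewrite [RHS]mxE [delta_mx _ _ _ _]mxE eq_idx_zer andbF mulr0.
by case: r => /=; rewrite block_mxEur mxE.
Qed.

Lemma bform_ep s i v : bform (ep s i) v = v (idx (~~ s) i) 0.
Proof. by rewrite /bform ep_beta -rowE mxE. Qed.

Lemma bform_e0 z v : bform (e0 z) v = 2%:R * v (zer l z) 0.
Proof. by rewrite /bform e0_beta -scalemxAl -rowE !mxE. Qed.

Definition epE :=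
  (bform_ep, bform_e0, ep_idx, ep_zer, e0_idx, e0_zer, negbK, eqxx).

Lemma bform_ep_self s i : bform (ep s i) (ep s i) = 0.
Proof. by rewrite !epE; case: s. Qed.

(** Also known as an Eichler transvection. That [e] is isotropic and orthogonal to [w], which makes
    it an isometry, is left to the lemmas. *)
Definition siegel e w : 'M[k]_n :=
  1%:M + (w *m e^T - e *m w^T - qform w *: (e *m e^T)) *m beta.

Lemma siegelE e w v :
  siegel e w *m v
  = v + bform e v *: w - bform w v *: e - (qform w * bform e v) *: e.
Proof.
rewrite /siegel mulmxDl mul1mx !mulmxBl -!scalemxAl -!mulmxA.
by rewrite !(mulmxA _ beta) !mul_bform scalerA !addrA.
Qed.

Lemma siegel0 e : siegel e 0 = 1%:M.
Proof.
apply: mx_ext => v.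
rewrite siegelE /qform !bformE mulr0 mul0r !scale0r scaler0.
by rewrite addr0 !subr0 mul1mx.
Qed.

Hypothesis k2 : 2%:R != 0 :> k.

Lemma qformD u v : qform (u + v) = qform u + qform v + bform u v.
Proof. by rewrite /qform !bformE (bformC v u); field. Qed.

(** Additivity in [w] gives inverses and allows [w] to be decomposed into simpler vectors. *)
Lemma siegelD e w w' : bform e e = 0 -> bform e w = 0 -> bform e w' = 0 ->
  siegel e (w + w') = siegel e w *m siegel e w'.
Proof.
move=> ee ew ew'; apply: mx_ext => v.
rewrite -mulmxA !siegelE !bformE qformD ee ew' (bformC w e) ew.
by apply/colP=> x; rewrite !mxE; ring.
Qed.

Lemma siegel_preserves_bform e w : bform e e = 0 -> bform e w = 0 ->
  preserves_bform (siegel e w).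
Proof.
move=> ee ew u v; rewrite !siegelE !bformE ee (bformC w e) ew.
rewrite (bform_qform k2 w).
by rewrite (bformC u e) (bformC u w); ring.
Qed.

Lemma siegel_reflections e w v :
  bform e e = 0 -> bform e w = 0 -> bform w w != 0 ->
  siegel e w *m v = reflection w (reflection (w + qform w *: e) v).
Proof.
move=> ee ew ww; rewrite siegelE.
have q0 : qform w != 0 by rewrite qform_eq0.
have qE : qform (w + qform w *: e) = qform w.
  by rewrite qformD {2}/qform !bformE (bformC w e) ew ee !mulr0 !addr0.
rewrite !(reflectionE k2) qE !bformE (bformC w e) ew (bform_qform k2 w).
by apply/colP=> x; rewrite !mxE; field.
Qed.

(** One decomposition with product in the class of [a] suffices here, so multiplicativity is mere
    concatenation; independence of the decomposition enters only in [spinor_normE]. *)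
Definition has_spinor g a := exists us : seq 'cV[k]_n,
  [/\ forall u, u \in us -> bform u u != 0,
      forall v, g *m v = foldr (@reflection k b l) v us
    & exists2 c, c != 0 & \prod_(u <- us) qform u = a * c ^+ 2].

Lemma has_spinor1 : has_spinor 1%:M 1.
Proof.
exists [::]; split=> // [v|]; first by rewrite mul1mx.
by exists 1; rewrite ?oner_neq0 // big_nil expr1n mulr1.
Qed.

Lemma has_spinor_mul g h a a' :
  has_spinor g a -> has_spinor h a' -> has_spinor (g *m h) (a * a').
Proof.
case=> us [us0 gus [c c0 dc]] [vs [vs0 hvs [d d0 dd]]].
exists (us ++ vs); split=> [u|v|].
- by rewrite mem_cat => /orP[/us0|/vs0].
- by rewrite -mulmxA hvs gus foldr_cat.
- by exists (c * d); rewrite ?mulf_neq0 // big_cat /= dc dd; ring.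
Qed.

Lemma has_spinor_reflection g u : bform u u != 0 ->
  (forall v, g *m v = reflection u v) -> has_spinor g (qform u).
Proof.
move=> u0 gu; exists [:: u]; split=> //.
  by move=> v; rewrite inE => /eqP->.
by exists 1; rewrite ?oner_neq0 // big_seq1 expr1n mulr1.
Qed.

Lemma has_spinor_siegel e w :
  bform e e = 0 -> bform e w = 0 -> bform w w != 0 ->
  has_spinor (siegel e w) 1.
Proof.
move=> ee ew ww; exists [:: w; w + qform w *: e].
have qE : qform (w + qform w *: e) = qform w.
  by rewrite qformD {2}/qform !bformE (bformC w e) ew ee !mulr0 !addr0.
split=> [u|v|].
- by rewrite !inE -(qform_eq0 k2) => /orP[]/eqP->; rewrite ?qE qform_eq0.
- by rewrite siegel_reflections.
- by exists (qform w); rewrite ?qform_eq0 // big_cons big_seq1 qE mul1r.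
Qed.

(* An isotropic [w] is the sum of the anisotropic [w + y] and [- y]. *)
Lemma has_spinor_siegel_isotropic e w y :
  bform e e = 0 -> bform e w = 0 -> bform e y = 0 ->
  bform y y != 0 -> bform (w + y) (w + y) != 0 -> has_spinor (siegel e w) 1.
Proof.
move=> ee ew ey yy wy.
rewrite -[w](addrK y) siegelD ?bformE ?ew ?ey ?addr0 ?oppr0 //.
rewrite -[1]mulr1; apply: has_spinor_mul; apply: has_spinor_siegel => //.
- by rewrite bformE ew ey addr0.
- by rewrite bformE ey oppr0.
- by rewrite !bformE opprK.
Qed.

(** Multiples of basis vectors outside the hyperbolic pair [i]. Their Siegel transformations along
    [ep s i] are the elementary matrices other than w_l. *)
Variant root_vector i : 'cV[k]_n -> Prop :=
  | RootHyp r j t of j != i : root_vector i (t *: ep r j)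
  | RootZer z t : root_vector i (t *: e0 z).

Lemma root_vector_ortho i w s : root_vector i w -> bform (ep s i) w = 0.
Proof.
case=> [r j t ji|z t]; rewrite bformE !epE ?mulr0 //.
by rewrite (negPf ji) andbF mulr0.
Qed.

Lemma has_spinor_root s i w :
  root_vector i w -> has_spinor (siegel (ep s i) w) 1.
Proof.
have e_e := bform_ep_self s i; move=> iw; have := root_vector_ortho s iw.
case: iw => [r j t ji|z t] ew; have [t0|t0] := eqVneq t 0;
  try by rewrite t0 scale0r siegel0; apply: has_spinor1.
(* For nonzero [t], the values of beta at [y] and [w + y] are [2 t] and [4 t], both nonzero. *)
- apply: (has_spinor_siegel_isotropic (y := t *: ep r j + ep (~~ r) j)) => //.
  + by rewrite !bformE !epE (negPf ji) !andbF mulr0 addr0.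
  + suff -> : bform (t *: ep r j + ep (~~ r) j) (t *: ep r j + ep (~~ r) j)
      = 2%:R * t by rewrite mulf_neq0.
    by rewrite !bformE !epE; case: r {ew} => /=; ring.
  + set y := _ + _; suff -> : bform y y = 2%:R * 2%:R * t by rewrite !mulf_neq0.
    by rewrite /y !bformE !epE; case: r {ew y} => /=; ring.
- apply: has_spinor_siegel => //.
  by rewrite !bformE !epE !mulf_neq0 ?oner_neq0.
Qed.

End Siegel.

(** * Elementary matrices as Siegel transformations *)

Section Elementary.
Variables (k : fieldType) (b : bool) (l : nat).
Local Notation n := (dimO b l).
Local Notation beta := (beta k b l).
Local Notation e x y := (delta_mx x y : 'M[k]_n).
Local Notation idx := (@idx b l).
Local Notation ep := (@ep k b l).
Local Notation e0 := (@e0 k b l).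
Implicit Types (u v w : 'cV[k]_n) (g x y : 'M[k]_n) (a t alpha lam : k).
Implicit Types (s r : bool) (i j : 'I_l) (z : 'I_b).

Lemma siegel_hyp s i r j t : j != i ->
  siegel (ep s i) (t *: ep r j)
  = 1%:M + t *: (e (idx r j) (idx (~~ s) i) - e (idx s i) (idx (~~ r) j)).
Proof.
move=> ji; have q0 : qform (t *: ep r j) = 0.
  by rewrite /qform !bformE bform_ep_self !mulr0.
rewrite /siegel q0 scale0r subr0 linearZ /= -scalemxAl -scalemxAr -scalerBr.
by rewrite -scalemxAl mulmxBl -!mulmxA !ep_beta !mul_delta_mx.
Qed.

Lemma siegel_zer (k2 : 2%:R != 0 :> k) s i z t :
  siegel (ep s i) (t *: e0 z)
  = 1%:M + t *: (e (zer l z) (idx (~~ s) i) - 2%:R *: e (idx s i) (zer l z))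
    - t ^+ 2 *: e (idx s i) (idx (~~ s) i).
Proof.
have q0 : qform (t *: e0 z) = t ^+ 2.
  by rewrite /qform !bformE !epE; field.
rewrite /siegel q0 linearZ /= -scalemxAl -scalemxAr -scalerBr.
rewrite mulmxBl -!scalemxAl mulmxBl -!mulmxA !ep_beta e0_beta -scalemxAr.
by rewrite !mul_delta_mx addrA.
Qed.

(* This is w_l if [i.+1 = l]. *)
Definition hyp_swap i : 'M[k]_n :=
  1%:M - e (pos b i) (pos b i) - e (neg b i) (neg b i)
       - e (pos b i) (neg b i) - e (neg b i) (pos b i).

Lemma elementary_root (k2 : 2%:R != 0 :> k) s i w :
  root_vector i w -> elementary (siegel (ep s i) w).
Proof.
case=> [r j t ji|z t].
- rewrite siegel_hyp //; case: s r => [] [] /=.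
  (* With equal signs the elementary matrices are indexed by ordered pairs only; exchanging the
     indices negates [t]. *)
  + case: (ltngtP j i) => [lt_ji|lt_ij|/val_inj eq_ji].
    * exact: elem_pos_neg.
    * rewrite -opprB scalerN -scaleNr; exact: elem_pos_neg.
    * by rewrite eq_ji eqxx in ji.
  + rewrite -opprB scalerN -scaleNr; apply: elem_pos_pos.
    by rewrite eq_sym.
  + exact: elem_pos_pos.
  + case: (ltngtP j i) => [lt_ji|lt_ij|/val_inj eq_ji].
    * exact: elem_neg_pos.
    * rewrite -opprB scalerN -scaleNr; exact: elem_neg_pos.
    * by rewrite eq_ji eqxx in ji.
- rewrite siegel_zer //; case: s => /=.
  + rewrite -[e _ _ - _]opprB scalerN -scaleNr -sqrrN; exact: elem_pos_zer.
  + rewrite [e _ _ - _]addrC; exact: elem_zer_pos.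
Qed.

(** Condenses the six matrix shapes into two geometric ones, the only cases in the later
    inductions. *)
Lemma elementaryP (k2 : 2%:R != 0 :> k) x : elementary x ->
  (exists s i w, root_vector i w /\ x = siegel (ep s i) w) \/
  (exists2 i : 'I_l, i.+1 = l & x = hyp_swap i).
Proof.
case=> [i j t ij|i j t ij|i j t ij|i il|z i t|z i t]; last 2 first.
- left; exists true, i, (- t *: e0 z); split; first exact: RootZer.
  by rewrite siegel_zer //= sqrrN scaleNr -scalerN opprB.
- left; exists false, i, (t *: e0 z); split; first exact: RootZer.
  by rewrite siegel_zer //= [e _ _ - _]addrC.
- left; exists false, j, (t *: ep true i).
  by rewrite siegel_hyp //; split; first exact: RootHyp.
- have ji : i != j by apply: contraTneq ij => ->; rewrite ltnn.
  left; exists true, j, (t *: ep true i).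
  by rewrite siegel_hyp //; split; first exact: RootHyp.
- have ji : i != j by apply: contraTneq ij => ->; rewrite ltnn.
  left; exists false, j, (t *: ep false i).
  by rewrite siegel_hyp //; split; first exact: RootHyp.
- by right; exists i.
Qed.

Lemma mul_delta_col p q v : e p q *m v = v q 0 *: delta_mx p 0.
Proof.
rewrite -(mul_delta_mx (0 : 'I_1)) -mulmxA -rowE [row q v]mx11_scalar.
by rewrite mul_mx_scalar mxE.
Qed.

Hypothesis k2 : 2%:R != 0 :> k.

Lemma qform_hyp_sum i : qform (ep true i + ep false i) = 1.
Proof. by rewrite /qform !bformE !epE /= !add0r !addr0; field. Qed.

Lemma bform_hyp_sum i :
  bform (ep true i + ep false i) (ep true i + ep false i) != 0.
Proof. by rewrite -qform_eq0 // qform_hyp_sum oner_neq0. Qed.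

Lemma hyp_swapE i v : hyp_swap i *m v = reflection (ep true i + ep false i) v.
Proof.
rewrite (reflectionE k2) qform_hyp_sum divr1 !bformE !epE /hyp_swap.
rewrite !mulmxBl mul1mx !mul_delta_col /=.
by apply/colP=> x; rewrite !mxE; ring.
Qed.

Lemma has_spinor_hyp_swap i : has_spinor (hyp_swap i) 1.
Proof.
rewrite -(qform_hyp_sum i); apply: has_spinor_reflection.
  exact: bform_hyp_sum.
exact: hyp_swapE.
Qed.

Lemma has_spinor_elementary x : elementary x -> has_spinor x 1.
Proof.
case/(elementaryP k2) => [[s [i [w [iw ->]]]]|[i _ ->]].
  exact: has_spinor_root.
exact: has_spinor_hyp_swap.
Qed.

Lemma has_spinor_elementary_seq xs :
  (forall x, x \in xs -> elementary x) -> has_spinor (mxprod xs) 1.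
Proof.
rewrite /mxprod; elim: xs => [|x xs IHxs] xs_el.
  by rewrite big_nil; apply: has_spinor1.
rewrite big_cons -[X in has_spinor _ X]mulr1; apply: has_spinor_mul.
  by apply/has_spinor_elementary/xs_el/mem_head.
by apply: IHxs => y yxs; apply: xs_el; rewrite inE yxs orbT.
Qed.

(** * Spinor norms of the diagonal factors *)

Lemma diag_factor_zer alpha lam v z :
  (diag_factor b l alpha lam *m v) (zer l z) 0 = alpha * v (zer l z) 0.
Proof. by rewrite mul_diag_mx mxE row_mxEl mxE. Qed.

Lemma diag_factor_idx alpha lam v s i :
  (diag_factor b l alpha lam *m v) (idx s i) 0
  = (if i.+1 == l then if s then lam else lam^-1 else 1) * v (idx s i) 0.
Proof.
by case: s; rewrite mul_diag_mx mxE row_mxEr ?row_mxEl ?row_mxEr mxE; case: ifP.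
Qed.

Lemma last_index i j : i.+1 = l -> (j.+1 == l) = (i == j).
Proof. by move=> il; rewrite [RHS]eq_sym -val_eqE /= -[RHS]eqSS il. Qed.

(** The reflection in [e_l - a e_-l] exchanges [e_l] and [a e_-l]. Taking a = [lam] first and then a
    = 1 scales [e_l] by [lam] and [e_-l] by its inverse. The two values of [qform] are [- lam] and
    -1, with product [lam]. *)
Lemma diag_factor_reflections lam i v : lam != 0 -> i.+1 = l ->
  diag_factor b l 1 lam *m v
  = reflection (ep true i - ep false i)
      (reflection (ep true i - lam *: ep false i) v).
Proof.
move=> lam0 il; have qE a : qform (ep true i - a *: ep false i) = - a.
  by rewrite /qform !bformE !epE /=; field.
have := qE 1; rewrite scale1r => q1.
rewrite !(reflectionE k2) q1 qE !bformE !epE /=.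
have colD (u w : 'cV[k]_n) q : (u + w) q 0 = u q 0 + w q 0 by rewrite mxE.
have colN (u : 'cV[k]_n) q : (- u) q 0 = - u q 0 by rewrite mxE.
have colZ a (u : 'cV[k]_n) q : (a *: u) q 0 = a * u q 0 by rewrite mxE.
apply/colP=> q; case: (indexP q) => [z|s j].
  rewrite diag_factor_zer !(colD, colN, colZ) !epE; ring.
rewrite diag_factor_idx !(colD, colN, colZ) !epE (last_index _ il).
by case: (eqVneq i j) => [<-|_]; case: s => /=; field;
  rewrite ?oppr_eq0 ?oner_neq0 ?lam0.
Qed.

Lemma has_spinor_diag lam i : lam != 0 -> i.+1 = l ->
  has_spinor (diag_factor b l 1 lam) lam.
Proof.
move=> lam0 il; have qE a : qform (ep true i - a *: ep false i) = - a.
  by rewrite /qform !bformE !epE /=; field.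
have := qE 1; rewrite scale1r => q1.
exists [:: ep true i - ep false i; ep true i - lam *: ep false i]; split.
- move=> u; rewrite !inE -(qform_eq0 k2) => /orP[]/eqP->.
    by rewrite q1 oppr_eq0 oner_neq0.
  by rewrite qE oppr_eq0.
- by move=> v; apply: diag_factor_reflections.
- by exists 1; rewrite ?oner_neq0 // big_cons big_seq1 q1 qE; ring.
Qed.

Lemma diag_factorM alpha lam alpha' lam' :
  diag_factor b l alpha lam *m diag_factor b l alpha' lam'
  = diag_factor b l (alpha * alpha') (lam * lam').
Proof.
apply: mx_ext => v; rewrite -mulmxA; apply/colP=> q.
case: (indexP q) => [z|s j]; first by rewrite !diag_factor_zer mulrA.
by rewrite !diag_factor_idx mulrA; case: ifP; case: s; rewrite ?mul1r // invfM.
Qed.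

(** For odd n, expressed by the presence of [z], this matrix is the reflection in [e0 z], where
    [qform] takes the value 1. *)
Lemma has_spinor_diag_sign z :
  has_spinor (diag_factor b l (- 1 : k) 1) 1.
Proof.
have q1 : qform (e0 z) = 1 by rewrite /qform !epE mulr1 mulVf.
rewrite -[X in has_spinor _ X]q1; apply: has_spinor_reflection => [|v].
  by rewrite -qform_eq0 // q1 oner_neq0.
rewrite reflectionE // q1 divr1 epE; apply/colP=> q.
case: (indexP q) => [z'|s j].
  by rewrite (zer_unique z' z) diag_factor_zer !mxE !eqxx /=; ring.
by rewrite diag_factor_idx invr1 !if_same mul1r !mxE eq_idx_zer mulr0 subr0.
Qed.

Lemma diag_factor_alpha alpha lam z :
  split_orthogonal (diag_factor b l alpha lam) ->
  (alpha == 1) || (alpha == - 1).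
Proof.
move/split_orthogonal_preserves_bform/(_ (e0 z) (e0 z)).
have -> : diag_factor b l alpha lam *m e0 z = alpha *: e0 z.
  apply/colP=> q; rewrite [RHS]mxE; case: (indexP q) => [z'|s j].
    by rewrite diag_factor_zer.
  by rewrite diag_factor_idx e0_idx !mulr0.
rewrite !bformE !epE mulrA mulr1 -expr2 => /(canRL (mulfK k2)).
by rewrite divff // => /eqP; rewrite sqrf_eq1.
Qed.

Lemma has_spinor_diag_factor alpha lam i : lam != 0 -> i.+1 = l ->
  split_orthogonal (diag_factor b l alpha lam) ->
  has_spinor (diag_factor b l alpha lam) lam.
Proof.
move=> lam0 il oD; have D1 := has_spinor_diag lam0 il.
(* Either n is odd and [alpha] differs from 1, hence is -1, or the matrix is the one with [alpha] =
   1, the block of [alpha] being empty for even n. *)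
case: (pickP (fun z : 'I_b => alpha != 1)) => [z a1|a1]; last first.
  suff <- : diag_factor b l 1 lam = diag_factor b l alpha lam by [].
  apply: mx_ext => v; apply/colP=> q; case: (indexP q) => [z|s j].
    by have /negbFE/eqP-> := a1 z.
  by rewrite !diag_factor_idx.
have := diag_factor_alpha z oD; rewrite (negPf a1) => /eqP->.
rewrite -[- 1]mulr1 -[lam]mul1r -diag_factorM.
by apply: has_spinor_mul; [exact: has_spinor_diag_sign z|].
Qed.

(** A second decomposition followed by the reverse of the first one is the identity, so the two
    products multiply to a square and have the same class. *)
Lemma spinor_normE g a : a != 0 -> has_spinor g a -> spinor_norm g = sqclass a.
Proof.
move=> a0 [us [us0 gus [c c0 dc]]]; apply/seteqP; split=> [d|d [s s0 ->]].
  case=> vs [vs0 gvs [s s0 ->]].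
  have [||r r0] := @reflections_id_square _ _ _ k2 (vs ++ rev us).
  - by move=> u; rewrite mem_cat mem_rev => /orP[/vs0|/us0].
  - by move=> v; rewrite foldr_cat -gvs gus foldr_reflectionK.
  have rev_prod : \prod_(u <- rev us) qform u = \prod_(u <- us) qform u.
    by apply: perm_big; rewrite perm_rev.
  rewrite big_cat /= rev_prod dc => vsr.
  exists (r / (a * c) * s); first by rewrite !mulf_neq0 ?invr_eq0 ?mulf_neq0.
  rewrite -[\prod_(_ <- _) _](mulfK (mulf_neq0 a0 (expf_neq0 2 c0))) vsr.
  by field; rewrite a0 c0.
exists us; split=> //; exists (s / c); first by rewrite mulf_neq0 ?invr_eq0.
by rewrite [\prod_(_ <- _) _]dc; field.
Qed.

End Elementary.

(** * Products of elementary matrices and their action on isotropic vectors *)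

Section Generation.
Variables (k : fieldType) (b : bool) (l : nat) (k2 : 2%:R != 0 :> k).
Local Notation n := (dimO b l).
Local Notation ep := (@ep k b l).
Local Notation e0 := (@e0 k b l).
Implicit Types (u v w : 'cV[k]_n) (g x y : 'M[k]_n) (a c t : k).
Implicit Types (s r : bool) (i j : 'I_l) (z : 'I_b).

Definition gen x := exists2 xs : seq 'M[k]_n,
  (forall y, y \in xs -> elementary y) & x = mxprod xs.

Lemma gen1 : gen 1%:M.
Proof. by exists [::]; rewrite // /mxprod big_nil. Qed.

Lemma genM x y : gen x -> gen y -> gen (x *m y).
Proof.
case=> xs xs_el -> [ys ys_el ->]; exists (xs ++ ys).
  by move=> z; rewrite mem_cat => /orP[/xs_el|/ys_el].
by rewrite /mxprod big_cat.
Qed.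

Lemma gen_elementary x : elementary x -> gen x.
Proof.
move=> x_el; exists [:: x]; first by move=> y; rewrite inE => /eqP->.
by rewrite /mxprod big_seq1.
Qed.

(** The hypotheses kill the coordinates of [w] at the pair [i]; the other terms of its basis
    expansion are root vectors, and additivity applies. *)
Lemma gen_siegel s i w :
  bform (ep s i) w = 0 -> bform (ep (~~ s) i) w = 0 ->
  gen (siegel (ep s i) w).
Proof.
rewrite !bform_ep negbK => w1 w2.
(* Orthogonality is carried along because additivity requires it of the partial sums. *)
pose K w' := bform (ep s i) w' = 0 /\ gen (siegel (ep s i) w').
suff [] : K w by [].
have -> : w = \sum_q w q 0 *: delta_mx q 0.
  by rewrite [LHS]matrix_sum_delta; apply: eq_bigr => q _; rewrite big_ord1.
have K0 : K 0 by rewrite /K bform0r siegel0; split=> //; apply: gen1.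
have KD : forall w1 w2, K w1 -> K w2 -> K (w1 + w2).
  move=> u v [u0 gu] [v0 gv]; split; first by rewrite bformE u0 v0 addr0.
  by rewrite siegelD ?bform_ep_self //; apply: genM.
have Kroot w' : root_vector i w' -> K w'.
  move=> iw; split; first exact: root_vector_ortho.
  exact/gen_elementary/elementary_root.
apply: (big_ind K) => // q _; case: (indexP q) => [z|r j].
  exact/Kroot/RootZer.
have [eq_ji|ji] := eqVneq j i; last exact/Kroot/RootHyp.
suff -> : w (idx b r j) 0 = 0 by rewrite scale0r.
by rewrite eq_ji; case: s r w1 w2 {K K0 KD Kroot} => [] [].
Qed.

(** Negating [w] inverts a Siegel transformation, and w_l is an involution. *)
Lemma gen_inv x : gen x -> exists2 y, gen y & y *m x = 1%:M.
Proof.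
case=> xs; elim: xs x => [|x' xs IHxs] x xs_el ->.
  by exists 1%:M; rewrite ?mul1mx /mxprod ?big_nil //; apply: gen1.
have [|y gy yx] := IHxs _ _ erefl.
  by move=> y yxs; apply: xs_el; rewrite inE yxs orbT.
suff [y' gy' yx'] : exists2 y', gen y' & y' *m x' = 1%:M.
  exists (y *m y'); first exact: genM.
  by rewrite /mxprod big_cons mulmxA -(mulmxA y) yx' mulmx1.
have := xs_el _ (mem_head _ _).
case/(elementaryP k2) => [[s [i [w [iw ->]]]]|[i il ->]].
  have eps_w r := root_vector_ortho r iw.
  exists (siegel (ep s i) (- w)).
    by apply: gen_siegel; rewrite bformE eps_w oppr0.
  rewrite -siegelD ?bform_ep_self ?bformE ?eps_w ?oppr0 // addNr.
  exact: siegel0.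
exists (hyp_swap k b i); first exact/gen_elementary/elem_w.
apply: mx_ext => v; rewrite -mulmxA !hyp_swapE // reflectionK ?mul1mx //.
exact: bform_hyp_sum.
Qed.

Lemma elementary_preserves_bform x : elementary x -> preserves_bform x.
Proof.
case/(elementaryP k2) => [[s [i [w [iw ->]]]]|[i il ->]].
  apply: siegel_preserves_bform => //.
    exact: bform_ep_self.
  exact: (root_vector_ortho s iw).
by move=> u v; rewrite !hyp_swapE // reflection_bform // bform_hyp_sum.
Qed.

Lemma gen_preserves_bform x : gen x -> preserves_bform x.
Proof.
case=> xs; elim: xs x => [|x' xs IHxs] x xs_el ->.
  by move=> u v; rewrite /mxprod big_nil !mul1mx.
rewrite /mxprod big_cons; apply: preserves_bform_mul.
  exact/elementary_preserves_bform/xs_el/mem_head.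
by apply: IHxs => // y yxs; apply: xs_el; rewrite inE yxs orbT.
Qed.

(** The last clause of the conclusion serves to keep basis vectors that are already fixed. *)
Lemma gen_transport s i v v' c : c != 0 ->
  bform v v = 0 -> bform v' v' = 0 ->
  bform (ep s i) v = c -> bform (ep s i) v' = c ->
  exists x, [/\ gen x, x *m v = v' & forall u,
    bform (ep s i) u = 0 -> bform v u = bform v' u -> x *m u = u].
Proof.
move=> c0 vv vv' ev ev'; set e := ep s i in ev ev' *.
(* Subtracting [d *: e] makes [w] orthogonal to the dual vector of [e] as well, as [gen_siegel]
   demands. *)
pose d := bform (ep (~~ s) i) (v' - v).
pose w := c^-1 *: (v' - v - d *: e).
have ee : bform e e = 0 := bform_ep_self k b s i.
have ew : bform e w = 0 by rewrite /w !bformE ev ev' ee; ring.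
have ew' : bform (ep (~~ s) i) w = 0.
  rewrite /w bformZr bformDr -/d bformNr bformZr /e !epE /=; ring.
exists (siegel e w); split; first exact: gen_siegel.
  (* The image of [v] is [v' - m *: e]. It is isotropic like [v'], so [2 m c] = 0 and [m]
     vanishes. *)
  pose m := d + bform w v + qform w * c.
  have E : siegel e w *m v = v' - m *: e.
    rewrite siegelE ev /m; move: (bform w v) (qform w) => p q.
    by apply/colP=> r; rewrite !mxE; field.
  have : bform (siegel e w *m v) (siegel e w *m v) = 0.
    by rewrite siegel_preserves_bform.
  rewrite E !bformE vv' (bformC v' e) ev' ee => H.
  suff -> : m = 0 by rewrite scale0r subr0.
  apply: (mulIf c0); apply: (mulfI k2).
  rewrite mul0r mulr0 -[RHS]oppr0 -[in RHS]H.
  ring.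
move=> u eu vu; rewrite siegelE eu.
have -> : bform w u = 0 by rewrite /w !bformE eu vu; ring.
by rewrite mulr0 !scale0r addr0 !subr0.
Qed.

(** Without hyperbolic coordinates [v] would be 0 or a nonzero multiple of the anisotropic [e0]. *)
Lemma isotropic_coordinate v : v != 0 -> bform v v = 0 ->
  exists s j, bform (ep s j) v != 0.
Proof.
move=> v0 vv.
case: (pickP (fun p : bool * 'I_l => bform (ep p.1 p.2) v != 0))
    => [[s j] sj|all0].
  by exists s, j.
have vidx s j : v (idx b s j) 0 = 0.
  by have /negbFE/eqP := all0 (~~ s, j); rewrite /= bform_ep negbK.
have vzer z : v (zer l z) 0 = 0.
  have vE : v = v (zer l z) 0 *: e0 z.
    apply/colP=> q; rewrite [RHS]mxE; case: (indexP q) => [z'|s j].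
      by rewrite epE mulr1 (zer_unique z' z).
    by rewrite epE mulr0.
  move/eqP: vv; rewrite {1}vE bformZl bform_e0 !mulf_eq0 (negPf k2) /= orbb.
  by move/eqP.
case/eqP: v0; apply/colP=> q; rewrite [RHS]mxE.
by case: (indexP q).
Qed.

(** * Fixing the hyperbolic pairs one after another *)

Definition fixes (J : pred 'I_l) x := forall j s, J j -> x *m ep s j = ep s j.

Lemma fixesM J x y : fixes J x -> fixes J y -> fixes J (x *m y).
Proof. by move=> fx fy j s Jj; rewrite -mulmxA fy ?fx. Qed.

Lemma bform_ep_neq s r i j : i != j -> bform (ep s i) (ep r j) = 0.
Proof. by move=> ij; rewrite !epE [j == i]eq_sym (negPf ij) andbF. Qed.

Lemma bform_ep_opp s i : bform (ep s i) (ep (~~ s) i) = 1.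
Proof. by rewrite !epE. Qed.

(* If [v] pairs nontrivially only with e_i or e_-i, it is first moved to
   e_i + e_i'; this is why a second free index [i'] is required. *)
Lemma gen_transport_hyp (J : pred 'I_l) i i' v :
  ~~ J i -> ~~ J i' -> i' != i -> v != 0 -> bform v v = 0 ->
  (forall j s, J j -> bform (ep s j) v = 0) ->
  exists x, [/\ gen x, x *m v = ep true i & fixes J x].
Proof.
move=> Ji Ji' i'i v0 vv vJ.
have JN j j' : J j -> ~~ J j' -> j' != j.
  by move=> Jj; apply: contraNneq => ->.
have pair_iso a s j c r j' : j != j' ->
    bform (a *: ep s j + c *: ep r j') (a *: ep s j + c *: ep r j') = 0.
  move=> jj'; have j'j : j' != j by rewrite eq_sym.
  rewrite !bformE !bform_ep_self !bform_ep_neq //.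
  by rewrite !(mulr0, addr0).
(* If [u] pairs nontrivially with a vector of index [j] other than [i], two moves suffice: along
   [ep s j] to [u'], which pairs to 1 with e_-i, then along e_-i to e_i. *)
have step u s j : u != 0 -> bform u u = 0 ->
    (forall j s, J j -> bform (ep s j) u = 0) ->
    bform (ep s j) u != 0 -> j != i ->
    exists x, [/\ gen x, x *m u = ep true i & fixes J x].
  move=> u0 uu uJ sj ji.
  have Jj : ~~ J j by apply: contraNN sj => Jj; rewrite uJ.
  set c := bform _ _ in sj.
  pose u' := c *: ep (~~ s) j + 1 *: ep true i.
  have uu' : bform u' u' = 0 by apply: pair_iso.
  have uJ' j' r : J j' -> bform u' (ep r j') = 0.
    move=> Jj'; rewrite /u' !bformE !bform_ep_neq ?JN //.
    by rewrite !mulr0 addr0.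
  have [|||||x [gx xu xJ]] := @gen_transport s j u u' c => //.
    by rewrite /u' !bformE bform_ep_opp bform_ep_neq // mulr1 mulr0 addr0.
  have [|||||x' [gx' xu' xJ']] := @gen_transport false i u' (ep true i) 1 => //.
  - exact: oner_neq0.
  - exact: bform_ep_self.
  - rewrite /u' !bformE -[true]/(~~ false) bform_ep_opp
       bform_ep_neq 1?eq_sym //.
    by rewrite mulr1 mulr0 add0r.
  - exact: bform_ep_opp.
  exists (x' *m x); split; first exact: genM.
    by rewrite -mulmxA xu.
  apply: fixesM => j' r Jj'; [apply: xJ'|apply: xJ].
  - by rewrite bform_ep_neq ?JN.
  - by rewrite uJ' // bform_ep_neq ?JN.
  - by rewrite bform_ep_neq ?JN.
  - by rewrite uJ' // bformC uJ.
have [s [j sj]] := isotropic_coordinate v0 vv.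
have [eq_ji|ji] := eqVneq j i; last exact: step sj ji.
rewrite {j}eq_ji in sj; set c := bform _ _ in sj.
pose u' := c *: ep (~~ s) i + 1 *: ep true i'.
have uu' : bform u' u' = 0 by apply: pair_iso; rewrite eq_sym.
have uJ' j' r : J j' -> bform (ep r j') u' = 0.
  move=> Jj'; rewrite bformC /u' !bformE !bform_ep_neq ?JN //.
  by rewrite !mulr0 addr0.
have [|||||x [gx xu xJ]] := @gen_transport s i v u' c => //.
  by rewrite /u' !bformE bform_ep_opp bform_ep_neq 1?eq_sym //
    mulr1 mulr0 addr0.
have u'1 : bform (ep false i') u' = 1.
  rewrite /u' !bformE -[true]/(~~ false) bform_ep_opp bform_ep_neq //.
  by rewrite mulr1 mulr0 add0r.
have [|||||x' [gx' xu' xJ']] := step u' false i' => //.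
- by apply: contra_eq_neq u'1 => ->; rewrite bform0r eq_sym oner_neq0.
- by rewrite u'1 oner_neq0.
exists (x' *m x); split; [exact: genM | by rewrite -mulmxA xu|].
apply: fixesM => // j' r Jj'; apply: xJ; first by rewrite bform_ep_neq ?JN.
by rewrite bformC vJ // bformC uJ'.
Qed.

(** First the image of e_i is moved back to e_i; then the image of e_-i, which now pairs to 1 with
    e_i, is moved back along e_i, and this fixes e_i. *)
Lemma gen_fix_step (J : pred 'I_l) g i i' : preserves_bform g -> fixes J g ->
  ~~ J i -> ~~ J i' -> i' != i ->
  exists2 x, gen x & fixes (predU1 i J) (x *m g).
Proof.
move=> gb gJ Ji Ji' i'i.
have JN j j' : J j -> ~~ J j' -> j' != j.
  by move=> Jj; apply: contraNneq => ->.
have [||||||x [gx xv xJ]] := @gen_transport_hyp J i i' (g *m ep true i) => //.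
- have := gb (ep true i) (ep false i); rewrite bform_ep_opp.
  by apply: contra_eq_neq => ->; rewrite bform0l eq_sym oner_neq0.
- by rewrite gb bform_ep_self.
- by move=> j s Jj; rewrite -(gJ j s Jj) gb bformC bform_ep_neq ?JN.
pose h := x *m g.
have hb : preserves_bform h.
  by apply: preserves_bform_mul => //; apply: gen_preserves_bform.
have hJ : fixes J h by apply: fixesM.
have hi : h *m ep true i = ep true i by rewrite -mulmxA.
have [|||||y [gy yv yJ]] :=
  @gen_transport true i (h *m ep false i) (ep false i) 1.
- exact: oner_neq0.
- by rewrite hb bform_ep_self.
- exact: bform_ep_self.
- by rewrite -{1}hi hb bform_ep_opp.
- exact: bform_ep_opp.
exists (y *m x); first exact: genM.
rewrite -mulmxA -/h => j s /predU1P[->|Jj]; rewrite -mulmxA.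
  case: s => //; rewrite hi yJ ?bform_ep_self // -[ep true i in LHS]hi hb.
  by [].
rewrite hJ // yJ // ?bform_ep_neq ?JN //.
by rewrite -{1}(hJ j s Jj) hb bform_ep_neq ?JN.
Qed.

(** Induction on the number of fixed pairs, with the last index as the second free index
    throughout. *)
Lemma gen_fix_initial g (i : 'I_l) : preserves_bform g -> i.+1 = l ->
  exists2 x, gen x & fixes (fun j => j != i) (x *m g).
Proof.
move=> gb il; suff: forall m, (m <= i)%N ->
    exists2 x, gen x & fixes (fun j : 'I_l => (j < m)%N) (x *m g).
  move/(_ i (leqnn i)) => [x gx xJ]; exists x => // j s ji; apply: xJ.
  by rewrite ltn_neqAle ji /= -ltnS il.
elim=> [|m IHm] lt_mi.
  by exists 1%:M => //; apply: gen1.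
have [x gx xJ] := IHm (ltnW lt_mi).
have lt_ml : (m < l)%N by rewrite (ltn_trans lt_mi).
have [|||||y gy yJ] :=
  @gen_fix_step (fun j => (j < m)%N) (x *m g) (Ordinal lt_ml) i.
- by apply: preserves_bform_mul => //; apply: gen_preserves_bform.
- exact: xJ.
- by rewrite /= ltnn.
- by rewrite -leqNgt ltnW.
- by rewrite -val_eqE /= gtn_eqF.
exists (y *m x); first exact: genM.
rewrite -mulmxA => j s /=; rewrite ltnS leq_eqVlt => jm; apply: yJ.
by apply/predU1P; case/orP: jm => [/eqP jm|]; [left; apply: val_inj|right].
Qed.

(** No second free index remains, so e_i is recovered only up to the scalar [c], which becomes
    [lam]. *)
Lemma gen_fix_last g (i : 'I_l) :
  preserves_bform g -> i.+1 = l -> fixes (fun j => j != i) g ->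
  exists x c, [/\ gen x, c != 0, fixes (fun j => j != i) (x *m g)
    & x *m g *m ep true i = c *: ep true i].
Proof.
move=> gb il gJ.
have neg_case h : preserves_bform h -> fixes (fun j => j != i) h ->
    bform (ep false i) (h *m ep true i) != 0 ->
  exists x c, [/\ gen x, c != 0, fixes (fun j => j != i) (x *m h)
    & x *m h *m ep true i = c *: ep true i].
  move=> hb hJ; set c := bform _ _ => c0.
  have [|||||x [gx xv xJ]] :=
    @gen_transport false i (h *m ep true i) (c *: ep true i) c => //.
  - by rewrite hb bform_ep_self.
  - by rewrite !bformE bform_ep_self !mulr0.
  - by rewrite bformZr bform_ep_opp mulr1.
  exists x, c; split; rewrite -?mulmxA // => j s ji.
  rewrite -mulmxA hJ // xJ // ?bform_ep_neq 1?eq_sym //.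
  by rewrite bformZl -{1}(hJ j s ji) hb !bform_ep_neq 1?eq_sym // mulr0.
have [g0|] := eqVneq (bform (ep false i) (g *m ep true i)) 0;
  last exact: neg_case.
have v0 : g *m ep true i != 0.
  have := gb (ep true i) (ep false i); rewrite bform_ep_opp.
  by apply: contra_eq_neq => ->; rewrite bform0l eq_sym oner_neq0.
have [|s [j sj]] := isotropic_coordinate v0; first by rewrite gb bform_ep_self.
have eq_ji : j = i.
  apply: contraNeq sj => ji.
  by rewrite -(gJ j s ji) gb bform_ep_neq.
rewrite {}eq_ji in sj; case: s sj; last by rewrite g0 eqxx.
(* Here the image of e_i pairs nontrivially with e_i but not with e_-i; w_l exchanges the two up to
   sign. *)
move=> c0; pose y := hyp_swap k b i.
have ey : gen y by apply/gen_elementary/elem_w.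
have [|||x [c [gx cc xJ xc]]] := neg_case (y *m g).
- by apply: preserves_bform_mul => //; apply: gen_preserves_bform.
- apply: fixesM => // j' s ji; rewrite hyp_swapE // reflectionE // bformDl.
  by rewrite !bform_ep_neq 1?eq_sym // addr0 mul0r scale0r subr0.
- rewrite -mulmxA hyp_swapE // (reflectionE k2) qform_hyp_sum // divr1.
  rewrite bformDr bformNr bformZr g0 bformDl g0 bformDr bform_ep_self.
  by rewrite -[true]/(~~ false) bform_ep_opp !addr0 mulr1 add0r oppr_eq0.
by exists (x *m y), c; rewrite -mulmxA; split=> //; apply: genM.
Qed.

(** * The remaining diagonal matrix *)

Lemma diag_factor_ep alpha lam s j :
  diag_factor b l alpha lam *m ep s j
  = (if j.+1 == l then if s then lam else lam^-1 else 1) *: ep s j.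
Proof.
apply/colP=> q; rewrite [RHS]mxE; case: (indexP q) => [z|r j'].
  by rewrite diag_factor_zer !epE !mulr0.
rewrite diag_factor_idx !epE.
case: (eqVneq j j') => [<-|_]; last by rewrite andbF !mulr0.
by case: (eqVneq s r) => [<-|_] //=; rewrite !mulr0.
Qed.

Lemma diag_factor_e0 alpha lam z :
  diag_factor b l alpha lam *m e0 z = alpha *: e0 z.
Proof.
apply/colP=> q; rewrite [RHS]mxE; case: (indexP q) => [z'|r j'].
  by rewrite diag_factor_zer.
by rewrite diag_factor_idx !epE !mulr0.
Qed.

Lemma mx_basis_ext x y : (forall s j, x *m ep s j = y *m ep s j) ->
  (forall z, x *m e0 z = y *m e0 z) -> x = y.
Proof.
move=> xy_ep xy_e0; apply/matrixP=> p q.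
suff /colP/(_ p) : x *m delta_mx q 0 = y *m (delta_mx q 0 : 'cV_n).
  by rewrite -!colE !mxE.
by case: (indexP q) => [z|s j]; [exact: xy_e0|exact: xy_ep].
Qed.

Lemma gen_diag g (i : 'I_l) : preserves_bform g -> i.+1 = l ->
  exists x alpha lam, [/\ gen x, alpha != 0, lam != 0
    & x *m g = diag_factor b l alpha lam].
Proof.
move=> gb il; have [x1 gx1 x1J] := gen_fix_initial gb il.
have [|x2 [c [gx2 c0 x2J x2c]]] := gen_fix_last _ il x1J.
  by apply: preserves_bform_mul => //; apply: gen_preserves_bform.
set h := x2 *m (x1 *m g) in x2J x2c.
have hb : preserves_bform h.
  by do 2?[apply: preserves_bform_mul => //; first exact: gen_preserves_bform].
(* As [h] is an isometry scaling e_i by [c], the image of e_-i pairs to [c^-1] with e_i and can be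
   moved to [c^-1] e_-i. *)
have [|||||x3 [gx3 x3v x3J]] :=
  @gen_transport true i (h *m ep false i) (c^-1 *: ep false i) c^-1.
- by rewrite invr_eq0.
- by rewrite hb bform_ep_self.
- by rewrite !bformE bform_ep_self !mulr0.
- apply: (mulfI c0); rewrite -bformZl -x2c hb -[false]/(~~ true) bform_ep_opp.
  by rewrite mulfV.
- by rewrite bformZr -[false]/(~~ true) bform_ep_opp mulr1.
pose f := x3 *m h.
have fb : preserves_bform f.
  by apply: preserves_bform_mul => //; apply: gen_preserves_bform.
pose d s j := if j.+1 == l then if s then c else c^-1 else 1.
have fep s j : f *m ep s j = d s j *: ep s j.
  rewrite /d /f -mulmxA (last_index _ il).
  have [<-|ij] := eqVneq i j.
    case: s => //; rewrite x2c -scalemxAr x3J // ?bform_ep_self //.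
    apply: (mulfI c0); rewrite -bformZr -x2c hb bformZl.
    by rewrite -[true]/(~~ false) bform_ep_opp mulr1 mulfV.
  have ji : j != i by rewrite eq_sym.
  rewrite scale1r x2J // x3J // ?bform_ep_neq //.
  by rewrite bformZl -{1}(x2J j s ji) hb !bform_ep_neq // mulr0.
have d0 s j : d s j != 0.
  by rewrite /d; case: ifP => _; case: s; rewrite ?invr_eq0 ?oner_neq0.
(* For odd n the image of [e0] is orthogonal to all hyperbolic pairs, hence a multiple of [e0]; for
   even n the value 1 is a default. *)
have [alpha [alpha0 falpha]] :
    exists alpha, alpha != 0 /\ forall z, f *m e0 z = alpha *: e0 z.
  case: (pickP (fun z : 'I_b => true)) => [z _|none]; last first.
    by exists 1; split=> [|z]; [exact: oner_neq0|have := none z].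
  set a := (f *m e0 z) (zer l z) 0.
  have fz : f *m e0 z = a *: e0 z.
    apply/colP=> q; rewrite [RHS]mxE; case: (indexP q) => [z'|s j].
      by rewrite (zer_unique z' z) epE mulr1.
    rewrite epE mulr0.
    have := bform_ep (~~ s) j (f *m e0 z); rewrite negbK => <-.
    apply: (mulfI (d0 (~~ s) j)); rewrite -bformZl -fep fb !epE.
    by rewrite mulr0.
  exists a; split=> [|z']; last by rewrite (zer_unique z' z).
  have := fb (e0 z) (e0 z); rewrite fz !bformE !epE.
  by apply: contra_eq_neq => ->; rewrite !mul0r eq_sym mulr1.
exists (x3 *m (x2 *m x1)), alpha, c; split=> //; first by do 2?apply: genM.
have -> : x3 *m (x2 *m x1) *m g = f by rewrite /f /h !mulmxA.
apply: mx_basis_ext => [s j|z]; first by rewrite fep diag_factor_ep.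
by rewrite falpha diag_factor_e0.
Qed.

Lemma preserves_bform_split g :
  g \in unitmx -> preserves_bform g -> split_orthogonal g.
Proof.
move=> gu gb; rewrite /split_orthogonal gu /=; apply/eqP/matrixP=> p q.
have := gb (delta_mx p 0) (delta_mx q 0).
rewrite /bform trmx_mul !mulmxA trmx_delta -!mulmxA -!rowE.
by rewrite !mulmxA -!colE !mxE.
Qed.

End Generation.

(** * Existence of the expression and its spinor norm *)

Theorem corollaryA1 (k : fieldType) (hk : 2%N \notin [pchar k]) (b : bool)
    (l : nat) (hl : (1 <= l)%N) (g : 'M[k]_(dimO b l))
    (hg : split_orthogonal g) :
  (exists (alpha lam : k) (xs ys : seq 'M[k]_(dimO b l)),
     expression g alpha lam xs ys) /\
  (forall (alpha lam : k) (xs ys : seq 'M[k]_(dimO b l)),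
     expression g alpha lam xs ys -> spinor_norm g = sqclass lam).
Proof.
have k2 := natr2_neq0 hk.
have [i il] : exists i : 'I_l, i.+1 = l.
  by case: l hl {g hg} => // m _; exists ord_max.
split=> [|alpha lam xs ys [[alpha0 lam0 oD] xs_el ys_el gE]].
  have gb := split_orthogonal_preserves_bform hg.
  have [x [alpha [lam [gx alpha0 lam0 xg]]]] := gen_diag k2 gb il.
  have [y [ys ys_el yE] yx] := gen_inv k2 gx.
  (* All elementary factors stand to the left of the diagonal one. *)
  exists alpha, lam, ys, [::]; split=> //; first split=> //.
    rewrite -xg; apply: preserves_bform_split.
      have [_ xu] := mulmx1_unit yx.
      by rewrite unitmx_mul xu; case/andP: hg.
    by apply: preserves_bform_mul => //; apply: gen_preserves_bform.
  rewrite /mxprod big_cat big_seq1 /= -/(mxprod ys) -yE -xg.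
  by rewrite [RHS]mulmxA yx mul1mx.
apply: spinor_normE => //; rewrite gE /mxprod big_cat big_cons /=.
rewrite -[lam in has_spinor _ lam]mul1r -[X in 1 * X]mulr1.
apply: has_spinor_mul; first exact: has_spinor_elementary_seq.
apply: has_spinor_mul; last exact: has_spinor_elementary_seq.
exact: has_spinor_diag_factor il oD.
Qed.
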